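(* Let $(f_1,\dots,f_n)$ be an $n$-player continuous game on $X=\mathbb{R}^{d_1}\times\cdots\times\mathbb{R}^{d_n}$ such that each $f_i\in C^q(X,\mathbb{R})$ for some $q\ge2$ and $\omega(x)=(D_1f_1(x),\dots,D_nf_n(x))$ is $L$-Lipschitz, and let $x^\ast\in X$ be a stable differential Nash equilibrium. Let $k_i\ge1$ for $i=1,\dots,n$, let $k_{\min}=\min_ik_i$, and let $\alpha,\beta,\tilde\alpha$ and the ball $B_r(x^\ast)$ be as defined in the context. Suppose that $x_0\in B_r(x^\ast)$, $\alpha<k_{\min}\beta$, $\sqrt{\alpha}/k_{\min}\le\sqrt{\tilde\alpha}$, and that for each $i$, $\gamma_i=\sqrt{\alpha}/(\beta k_i)$. Then, given $\varepsilon>0$, the gradient-based learning dynamics $x_{k+1}=x_k-\Gamma\omega(x_k)$ with $\Gamma=\mathrm{blockdiag}(\gamma_1I_{d_1},\dots,\gamma_nI_{d_n})$ obtain an $\varepsilon$-differential Nash equilibrium, in the sense that $x_k\in B_\varepsilon(x^\ast)$ for all $$k\ge\left\lceil 2\,\frac{\beta k_{\min}}{\alpha}\,\log\left(\frac r\varepsilon\right)\right\rceil.$$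
   Context: Player $i$ chooses $x_i\in\mathbb{R}^{d_i}$ and has cost $f_i:X\to\mathbb{R}$; $d=\sum_id_i$; $D_if_i$ is the derivative of $f_i$ with respect to $x_i$ and $D_i^2f_i$ the second derivative with respect to $x_i$. $J(x)$ is the Jacobian of $\omega$ at $x$ and $S(x)=\frac12(J(x)+J(x)^T)$. Given the $k_i$, let $\tilde\omega=(D_if_i/k_i)_{i=1}^n$, $\tilde J=D\tilde\omega$ its Jacobian, and $\tilde S=\frac12(\tilde J^T+\tilde J)$. For a symmetric $d\times d$ matrix $A$, $\lambda_d(A)\le\cdots\le\lambda_1(A)$ are its eigenvalues. A point $x^\ast$ is a differential Nash equilibrium if $\omega(x^\ast)=0$ and $D_i^2f_i(x^\ast)$ is positive definite for each $i$; it is stable if every eigenvalue of $J(x^\ast)$ has strictly positive real part. $B_r(x^\ast)$ is the largest Euclidean ball around $x^\ast$, contained in the region of attraction $\mathcal{V}(x^\ast)$ of $x^\ast$ for $\dot x=-\omega(x)$, on which $\tilde S$ is positive definite and $S^TS$ is positive definite. Finally, $$\alpha=\min_{x\in B_r(x^\ast)}\lambda_d\big(S(x)^TS(x)\big),\quad \beta=\max_{x\in B_r(x^\ast)}\lambda_1\big(J(x)^TJ(x)\big),\quad \tilde\alpha=\min_{x\in B_r(x^\ast)}\lambda_d\big(\tilde S(x)^T\tilde S(x)\big).$$ *)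

(* Defs.v *)
From HB Require Import structures.
From mathcomp Require Import all_boot all_order all_algebra complex.
From mathcomp Require Import all_classical all_reals all_analysis.
Set Implicit Arguments.
Unset Strict Implicit.
Unset Printing Implicit Defensive.
Import Order.TTheory GRing.Theory Num.Theory numFieldNormedType.Exports.
Local Open Scope classical_set_scope.
Local Open Scope ring_scope.

(* Points of R^m are row vectors, following the convention of [jacobian]. *)

(* The library norm on 'rV[R]_m is the sup norm. *)
Definition enorm (R : realType) (m : nat) (v : 'rV[R]_m) : R :=
  Num.sqrt (\sum_j v 0 j ^+ 2).

Definition eball (R : realType) (m : nat) (c : 'rV[R]_m) (r : R) :
  set 'rV[R]_m := [set x | enorm (x - c) < r].

Definition elipschitz (R : realType) (m p : nat) (L : R)
    (g : 'rV[R]_m -> 'rV[R]_p) : Prop :=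
  forall x y, enorm (g x - g y) <= L * enorm (x - y).

(* In finite dimension Dg is C^q as a map into the linear forms if and only if
   x |-> Dg(x)v is C^q for every v. *)
Fixpoint Cn (R : realType) (m : nat) (q : nat) (g : 'rV[R]_m -> R) : Prop :=
  if q is q'.+1 then
    (forall x, differentiable g x) /\ (forall v, Cn q' (fun x => 'D_v g x))
  else continuous g.

Definition grad (R : realType) (m : nat) (g : 'rV[R]_m -> R) (x : 'rV[R]_m) :
  'rV[R]_m := \row_j 'D_(delta_mx 0 j) g x.

(* The transpose turns the row-vector convention of [jacobian] into the usual
   one: Jac g x a b is the derivative of the a-th component of g with respect to
   the b-th coordinate. *)
Definition Jac (R : realType) (m p : nat) (g : 'rV[R]_m -> 'rV[R]_p)
  (x : 'rV[R]_m) : 'M[R]_(p, m) := (jacobian g x)^T.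

Definition sympart (R : realType) (m : nat) (A : 'M[R]_m) : 'M[R]_m :=
  2^-1 *: (A + A^T).

(* Only used for symmetric A. *)
Definition posdef (R : realType) (m : nat) (A : 'M[R]_m) : Prop :=
  forall v : 'rV[R]_m, v != 0 -> 0 < (v *m A *m v^T) 0 0.

(* Eigenvalues with multiplicity, in nonincreasing order. There is exactly one
   such sequence when A is symmetric; the default [::] is for matrices whose
   characteristic polynomial does not split over R. *)
Definition eigvals (R : realType) (m : nat) (A : 'M[R]_m) : seq R :=
  xget [::] [set s | sorted >=%R s /\
                     char_poly A = \prod_(a <- s) ('X - a%:P)].

(* Numbered from 1: [lambda 1 A] is the largest eigenvalue of A and
   [lambda m A] the smallest. *)
Definition lambda (R : realType) (m : nat) (i : nat) (A : 'M[R]_m) : R :=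
  nth 0 (eigvals A) i.-1.

Section Game.
Variables (R : realType) (n : nat) (d : 'I_n.+1 -> nat).

Local Notation X := 'rV[R]_(\sum_i d i).

Definition Dblock (i : 'I_n.+1) (g : X -> R) (x : X) : 'rV[R]_(d i) :=
  submxrow (grad g x) i.

Definition D2block (i : 'I_n.+1) (g : X -> R) (x : X) : 'M[R]_(d i) :=
  submxblock (Jac (grad g) x) i i.

Definition omega (f : 'I_n.+1 -> X -> R) (x : X) : X :=
  \mxrow_i Dblock i (f i) x.

Definition omegat (f : 'I_n.+1 -> X -> R) (k : 'I_n.+1 -> R) (x : X) : X :=
  \mxrow_i ((k i)^-1 *: Dblock i (f i) x).

Definition gameJ (f : 'I_n.+1 -> X -> R) (x : X) := Jac (omega f) x.

Definition gameS (f : 'I_n.+1 -> X -> R) (x : X) := sympart (gameJ f x).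

Definition gameJt (f : 'I_n.+1 -> X -> R) (k : 'I_n.+1 -> R) (x : X) :=
  Jac (omegat f k) x.

Definition gameSt (f : 'I_n.+1 -> X -> R) (k : 'I_n.+1 -> R) (x : X) :=
  sympart (gameJt f k x).

Definition differential_Nash (f : 'I_n.+1 -> X -> R) (xs : X) : Prop :=
  omega f xs = 0 /\ forall i, posdef (D2block i (f i) xs).

Definition stable (f : 'I_n.+1 -> X -> R) (xs : X) : Prop :=
  forall z : complex R,
    eigenvalue (map_mx (real_complex R) (gameJ f xs)) z -> 0 < complex.Re z.

(* Only the restriction of phi to [0, +oo[ matters. *)
Definition flow_line (g : X -> X) (x : X) (phi : R -> X) : Prop :=
  [/\ phi 0 = x,
      {within [set t | 0 <= t], continuous phi} &
      forall t : R, 0 < t -> is_derive t 1 phi (- g (phi t))].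

Definition attraction_region (g : X -> X) (xs : X) : set X :=
  [set x | exists phi : R -> X,
    flow_line g x phi /\ phi t @[t --> +oo%R] --> xs].

Definition admissible_radius (f : 'I_n.+1 -> X -> R) (k : 'I_n.+1 -> R)
    (xs : X) (r : R) : Prop :=
  eball xs r `<=` attraction_region (omega f) xs /\
  forall x, eball xs r x ->
    posdef (gameSt f k x) /\ posdef ((gameS f x)^T *m gameS f x).

(* The balls are open: the admissible open balls are then closed under
   increasing unions, so that a largest one exists as soon as the admissible
   radii are bounded and not all nonpositive. A largest admissible closed ball
   need not exist, since the conditions on x are open. *)
Definition largest_radius (f : 'I_n.+1 -> X -> R) (k : 'I_n.+1 -> R)
    (xs : X) (r : R) : Prop :=
  [/\ 0 < r, admissible_radius f k xs r &
      forall r', admissible_radius f k xs r' -> r' <= r].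

(* On the open ball the extrema need not be attained; by continuity the
   infima and the supremum are the minima and the maximum over the closed
   ball. *)
Definition alpha_of (f : 'I_n.+1 -> X -> R) (xs : X) (r : R) : R :=
  inf [set lambda (\sum_i d i)%N ((gameS f x)^T *m gameS f x) | x in eball xs r].

Definition beta_of (f : 'I_n.+1 -> X -> R) (xs : X) (r : R) : R :=
  sup [set lambda 1 ((gameJ f x)^T *m gameJ f x) | x in eball xs r].

Definition alphat_of (f : 'I_n.+1 -> X -> R) (k : 'I_n.+1 -> R)
    (xs : X) (r : R) : R :=
  inf [set lambda (\sum_i d i)%N ((gameSt f k x)^T *m gameSt f k x)
      | x in eball xs r].

Definition Gamma (gam : 'I_n.+1 -> R) : 'M[R]_(\sum_i d i) :=
  \mxdiag_i (gam i)%:M.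

End Game.

(* Main.v *)
Require Import Defs.
From HB Require Import structures.
From mathcomp Require Import all_boot all_order all_algebra complex.
From mathcomp Require Import all_classical all_reals all_analysis.
From mathcomp Require Import ring lra.
Set Implicit Arguments.
Unset Strict Implicit.
Unset Printing Implicit Defensive.
Import Order.TTheory GRing.Theory Num.Theory numFieldNormedType.Exports.
Local Open Scope classical_set_scope.
Local Open Scope ring_scope.

(** Let W be the reweighted vector field [omegat], whose i-th block is
    D_i f_i / k_i. As gamma_i = (sqrt alpha / beta) / k_i, the dynamics is plain
    gradient play x - g W(x) with the single step size g = sqrt alpha / beta,
    and the equilibrium is a zero of W. On the ball, with h a direction and
    D_h W the derivative of W in that direction:

    - D_h W . h = h (sym. part of DW) h^T >= sqrt alphat |h|^2
      >= (sqrt alpha / kmin) |h|^2. The symmetric part St is positive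
      definite, so its eigenvalues are the positive square roots of those of
      St^T St, which are at least alphat ([posdef_lambda_sqrt]).
    - |D_h W|^2 <= |D_h omega|^2 / kmin^2 <= (beta / kmin^2) |h|^2, because W
      rescales each coordinate of omega by at most 1 / kmin
      ([sqnorm_derive_scale_le]), and beta bounds the Rayleigh quotient of
      J^T J ([rayleigh_lambda]).

    Expanding |h - g D_h W|^2 then bounds it by

      (1 - 2 alpha / (beta kmin) + alpha / (beta kmin^2)) |h|^2
        <= (1 - alpha / (beta kmin)) |h|^2,

    where the inequality uses kmin >= 1. Integrating along the segment from the
    equilibrium, which stays in the ball, turns this into a contraction of the
    squared distance to the equilibrium ([sqnorm_step_le]). Hence the iterates
    stay in the ball and the squared distance decays like
    exp (- t alpha / (beta kmin)); the number of steps in the theorem is what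
    brings r^2 below eps^2 ([geometric_lt_sqr]).

    The existence of the extrema defining alphat and beta costs nothing: the
    infimum or supremum of a set without one is 0 by convention, whereas the
    hypotheses force alphat and beta to be positive ([inf_le_of_gt0],
    [le_sup_of_gt0]).

    The spectral facts come from diagonalizing a real symmetric matrix over the
    complex numbers, where it is Hermitian, and reading the result back over
    the reals ([symmetric_spectral]). *)

(** * Squared Euclidean norm *)

Definition sqnorm (R : realType) (m : nat) (v : 'rV[R]_m) : R :=
  \sum_j v 0 j ^+ 2.

Lemma sqnormE (R : realType) (m : nat) (v : 'rV[R]_m) :
  sqnorm v = (v *m v^T) 0 0.
Proof. by rewrite mxE; apply: eq_bigr => j _; rewrite mxE expr2. Qed.

Lemma sqnorm_ge0 (R : realType) m (v : 'rV[R]_m) : 0 <= sqnorm v.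
Proof. by apply: sumr_ge0 => i _; exact: sqr_ge0. Qed.

Lemma sqnorm_gt0 (R : realType) m (v : 'rV[R]_m) : v != 0 -> 0 < sqnorm v.
Proof.
move=> v0; rewrite lt_neqAle sqnorm_ge0 andbT eq_sym; apply: contra v0.
rewrite /sqnorm psumr_eq0 => [|i _]; last exact: sqr_ge0.
move=> /allP v0; apply/eqP/rowP => j; rewrite mxE; apply/eqP.
by rewrite -sqrf_eq0; exact: (v0 j (mem_index_enum _)).
Qed.

Lemma sqnormZ (R : realType) m (a : R) (v : 'rV[R]_m) :
  sqnorm (a *: v) = a ^+ 2 * sqnorm v.
Proof.
by rewrite /sqnorm mulr_sumr; apply: eq_bigr => j _; rewrite mxE exprMn.
Qed.

Lemma sqnormB (R : realType) m (u v : 'rV[R]_m) :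
  sqnorm (u - v) = sqnorm u - 2 * (u *m v^T) 0 0 + sqnorm v.
Proof.
rewrite /sqnorm mxE mulr_sumr -sumrB -big_split /=; apply: eq_bigr => j _.
by rewrite !mxE sqrrB mulr_natl.
Qed.

Lemma sqnorm_mul (R : realType) m p (v : 'rV[R]_m) (B : 'M[R]_(m, p)) :
  sqnorm (v *m B) = (v *m (B *m B^T) *m v^T) 0 0.
Proof. by rewrite sqnormE trmx_mul !mulmxA. Qed.

Lemma eball_sqnorm (R : realType) m (c x : 'rV[R]_m) (r : R) : 0 < r ->
  eball c r x <-> sqnorm (x - c) < r ^+ 2.
Proof.
move=> r_gt0; rewrite /eball /= /enorm.
rewrite -[X in _ < X <-> _](ger0_norm (ltW r_gt0)).
by rewrite -sqrtr_sqr ltr_sqrt // exprn_gt0.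
Qed.

(** * Spectral theory of real symmetric matrices *)

Lemma char_poly_similar (F : fieldType) m (P D : 'M[F]_m) : P \in unitmx ->
  char_poly (invmx P *m D *m P) = char_poly D.
Proof.
move=> Pu; rewrite /char_poly /char_poly_mx.
have -> : 'X%:M - map_mx polyC (invmx P *m D *m P) =
   map_mx polyC (invmx P) *m ('X%:M - map_mx polyC D) *m map_mx polyC P.
  rewrite mulmxBr mulmxBl !map_mxM /=; congr (_ - _).
  by rewrite scalar_mxC -(mulmxA 'X%:M) -map_mxM mulVmx // map_mx1 mulmx1.
rewrite !det_mulmx mulrC mulrA -det_mulmx -map_mxM mulmxV // map_mx1 det1.
by rewrite mul1r.
Qed.

Lemma root_bigprod_XsubC (R : idomainType) (I : finType) (s : I -> R) (i : I) :
  root (\prod_j ('X - (s j)%:P)) (s i).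
Proof.
by apply/rootP; rewrite horner_prod (bigD1 i) //= !hornerE subrr mul0r.
Qed.

(** Over the complex numbers A = P^* D P with P unitary and D diagonal, real
    since A is Hermitian. The coordinates of v P^* are complex, so only their
    squared moduli are kept, as the weights w: unlike an orthogonal basis of
    real eigenvectors these descend to the reals at once, and they suffice for
    all estimates on the quadratic form. *)
Lemma symmetric_spectral (R : realType) m (A : 'M[R]_m) : A^T = A ->
  exists2 s : 'I_m -> R, char_poly A = \prod_i ('X - (s i)%:P) &
  forall v : 'rV[R]_m, exists w : 'I_m -> R,
    [/\ forall i, 0 <= w i, sqnorm v = \sum_i w i &
        (v *m A *m v^T) 0 0 = \sum_i s i * w i].
Proof.
move=> Asym.
pose AC : 'M[complex R]_m := map_mx (real_complex R) A.
have AC_herm : AC \is hermitianmx _ false (@Num.conj _).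
  apply: realsym_hermsym.
    apply/is_hermitianmxP; rewrite expr0 scale1r map_mx_id //.
    by rewrite /AC map_trmx Asym.
  by apply/mxOverP => i j; rewrite mxE; apply/complex_realP; eexists.
pose P := spectralmx AC; pose D := spectral_diag AC.
have Pu : P \is unitarymx by exact: spectral_unitarymx.
have ACE : AC = invmx P *m diag_mx D *m P.
  exact/orthomx_spectralP/hermitian_normalmx.
have Dreal i : real_complex R (complex.Re (D 0 i)) = D 0 i.
  by apply: RRe_real; apply: (mxOverP (hermitian_spectral_diag_real AC_herm)).
exists (fun i => complex.Re (D 0 i)).
  apply: (map_poly_inj (real_complex R)).
  rewrite map_char_poly -/AC ACE char_poly_similar ?unitarymx_unit //.
  rewrite char_poly_trig ?diag_mx_is_trig // rmorph_prod.
  apply: eq_bigr => i _; rewrite rmorphB /= map_polyX map_polyC /= Dreal.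
  by rewrite !mxE eqxx mulr1n.
move=> v; pose vC : 'rV[complex R]_m := map_mx (real_complex R) v.
pose u := vC *m map_mx Num.conj P^T.
have uE : map_mx Num.conj u^T = P *m vC^T.
  rewrite /u trmx_mul map_mxM -map_trmx trmxK -map_mx_comp /=.
  rewrite (map_mx_id (f := _ \o _)) => [|z]; last exact: conjCK.
  congr (_ *m _); apply/matrixP => i j; rewrite !mxE.
  by apply/CrealP/complex_realP; eexists.
have wreal i : real_complex R (complex.Re (`|u 0 i| ^+ 2)) = `|u 0 i| ^+ 2.
  by apply: RRe_real; rewrite realX // normr_real.
exists (fun i => complex.Re (`|u 0 i| ^+ 2)); split.
- by move=> i; rewrite -lecR wreal; exact: (exprn_ge0 2 (normr_ge0 _)).
- apply: (@complexI R); rewrite sqnormE.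
  have -> : real_complex R ((v *m v^T) 0 0) = (vC *m vC^T) 0 0.
    by rewrite /vC map_trmx -map_mxM [RHS]mxE.
  rewrite rmorph_sum /=.
  have -> : vC *m vC^T = u *m map_mx Num.conj u^T.
    rewrite uE /u mulmxA -(mulmxA vC).
    by rewrite -invmx_unitary // mulVmx ?unitarymx_unit // mulmx1.
  by rewrite mxE; apply: eq_bigr => i _; rewrite wreal !mxE normCK.
- apply: (@complexI R).
  have -> : real_complex R ((v *m A *m v^T) 0 0) = (vC *m AC *m vC^T) 0 0.
    by rewrite /vC map_trmx -!map_mxM [RHS]mxE.
  rewrite rmorph_sum /= ACE invmx_unitary // !mulmxA -/u -mulmxA -uE.
  rewrite mxE; apply: eq_bigr => i _.
  rewrite rmorphM /= wreal Dreal mul_mx_diag !mxE normCK.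
  by rewrite mulrAC mulrC mulrA.
Qed.

(** The default value in the definition of [eigvals] is never taken on
    symmetric matrices, because their characteristic polynomial splits. *)
Lemma eigvals_symmetric (R : realType) m (A : 'M[R]_m) : A^T = A ->
  sorted >=%R (eigvals A) /\
  char_poly A = \prod_(a <- eigvals A) ('X - a%:P).
Proof.
move=> /symmetric_spectral[s sE _].
apply: (xgetPex (P := [set t | sorted >=%R t /\ _]) [::]).
exists (sort >=%R [seq s i | i <- enum 'I_m]); split.
  by apply: sort_sorted => a b; exact: le_total.
by rewrite sE (perm_big _ (permEl (perm_sort _ _))) /= big_map big_enum.
Qed.

Lemma root_char_poly_lambda (R : realType) m (A : 'M[R]_m) a : A^T = A ->
  root (char_poly A) a -> lambda m A <= a <= lambda 1 A.
Proof.
move=> /eigvals_symmetric[s_sorted sE]; rewrite sE root_prod_XsubC => a_s.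
have size_s : size (eigvals A) = m.
  by apply/eqP; rewrite -eqSS -(size_char_poly A) sE size_prod_XsubC.
have nth_mono := sorted_leq_nth (@ge_trans _ R) (@ge_refl _ R) 0 s_sorted.
have a_lt : (index a (eigvals A) < m)%N.
  by rewrite -[X in (_ < X)%N]size_s index_mem.
have m_gt0 : (0 < m)%N := leq_ltn_trans (leq0n _) a_lt.
rewrite /lambda -[a in X in X && _](nth_index 0 a_s).
rewrite -[a in X in _ && X](nth_index 0 a_s).
apply/andP; split; apply: nth_mono; rewrite ?inE ?size_s ?prednK //.
by rewrite -ltnS prednK.
Qed.

Lemma rayleigh_lambda (R : realType) m (A : 'M[R]_m) (v : 'rV[R]_m) :
  A^T = A ->
  lambda m A * sqnorm v <= (v *m A *m v^T) 0 0 <= lambda 1 A * sqnorm v.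
Proof.
move=> Asym; have [s sE /(_ v)[w [w_ge0 -> ->]]] := symmetric_spectral Asym.
have s_bound i : lambda m A <= s i <= lambda 1 A.
  by apply: root_char_poly_lambda => //; rewrite sE root_bigprod_XsubC.
rewrite !mulr_sumr; apply/andP; split; apply: ler_sum => i _;
  by apply: ler_wpM2r => //; case/andP: (s_bound i).
Qed.

(** Every eigenvalue s of A is positive, by evaluating A at an eigenvector u,
    and the Rayleigh quotient of A^T A at u is s^2; so s^2 >= a. Without
    positive definiteness only |s| >= sqrt a would follow. *)
Lemma posdef_lambda_sqrt (R : realType) m (A : 'M[R]_m) (a : R)
    (v : 'rV[R]_m) : A^T = A -> posdef A -> a <= lambda m (A^T *m A) ->
  Num.sqrt a * sqnorm v <= (v *m A *m v^T) 0 0.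
Proof.
move=> Asym Apos a_le.
have [s sE /(_ v)[w [w_ge0 -> ->]]] := symmetric_spectral Asym.
rewrite mulr_sumr; apply: ler_sum => i _; apply: ler_wpM2r => //.
have /eigenvalueP[u uA u0] : eigenvalue A (s i).
  by rewrite eigenvalue_root_char sE root_bigprod_XsubC.
have u_gt0 := sqnorm_gt0 u0.
have s_gt0 : 0 < s i.
  by have := Apos u u0; rewrite uA -scalemxAl mxE -sqnormE pmulr_lgt0.
have : lambda m (A^T *m A) * sqnorm u <= s i ^+ 2 * sqnorm u.
  have AAsym : (A^T *m A)^T = A^T *m A by rewrite trmx_mul trmxK.
  have -> : s i ^+ 2 * sqnorm u = (u *m (A^T *m A) *m u^T) 0 0.
    by rewrite -sqnormZ -uA sqnorm_mul Asym.
  by case/andP: (rayleigh_lambda u AAsym).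
rewrite ler_pM2r // => /(le_trans a_le) a_le_s2.
by rewrite -(ger0_norm (ltW s_gt0)) -sqrtr_sqr ler_wsqrtr.
Qed.

(** The transpose is there because [Jac] is the transpose of [jacobian], and it
    is the latter that computes directional derivatives of row vectors. *)
Lemma sympart_quad (R : realType) m (A : 'M[R]_m) (v : 'rV[R]_m) :
  (v *m sympart A *m v^T) 0 0 = (v *m A^T *m v^T) 0 0.
Proof.
have AT : (v *m A *m v^T) 0 0 = (v *m A^T *m v^T) 0 0.
  transitivity ((v *m A *m v^T)^T 0 0); first by rewrite [RHS]mxE.
  by rewrite !trmx_mul trmxK mulmxA.
rewrite /sympart -scalemxAr -scalemxAl mulmxDr mulmxDl.
rewrite [LHS]mxE [X in _ * X]mxE AT.
by field.
Qed.

(** * Mean value inequality for maps between Euclidean spaces *)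

Lemma differentiable_rV (R : realType) (V : normedModType R) p
    (F : V -> 'rV[R]_p) (x : V) :
  (forall j, differentiable (fun y => F y 0 j) x) -> differentiable F x.
Proof.
move=> dF.
have -> : F = \sum_j (fun y => F y 0 j *: (delta_mx 0 j : 'rV[R]_p)).
  by apply/funext => y; rewrite fct_sumE -row_sum_delta.
by apply: differentiable_sum => j; exact: differentiableZl.
Qed.

(** The difference quotients of both sides are the same function. *)
Lemma is_derive_line (R : realType) (V W : normedModType R) (F : V -> W)
    (y h : V) (s : R) : derivable F (y + s *: h) h ->
  is_derive s 1 (fun t => F (y + t *: h)) ('D_h F (y + s *: h)).
Proof.
move=> dF.
have lineE : (fun t : R => t^-1 *:
     (((fun t => F (y + t *: h)) \o shift s) (t *: (1 : R)) - F (y + s *: h)))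
   = (fun t : R => t^-1 *:
     ((F \o shift (y + s *: h)) (t *: h) - F (y + s *: h))).
  apply/funext => t /=.
  by rewrite [_ *: 1]mulr1 scalerDl addrCA.
by split; rewrite /derivable /derive /= lineE.
Qed.

(** A vector-valued mean value inequality from the scalar one. With
    w = F (y + h) - F y, the scalar function t |-> F (y + t h) . w increases by
    |w|^2 over [0, 1], so |w|^2 = u . w for a derivative u of F in the
    direction h at some point of the segment. Then
    0 <= |u - w|^2 = |u|^2 - |w|^2. *)
Lemma sqnorm_increment_le (R : realType) m p (F : 'rV[R]_m -> 'rV[R]_p)
    (y h : 'rV[R]_m) (C : R) : (forall x, differentiable F x) ->
  (forall s, 0 < s < 1 -> sqnorm ('D_h F (y + s *: h)) <= C) ->
  sqnorm (F (y + h) - F y) <= C.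
Proof.
move=> dF DF_le; set w := F (y + h) - F y.
pose g (t : R) := (F (y + t *: h) *m w^T) 0 0.
pose dg (t : R) := ('D_h F (y + t *: h) *m w^T) 0 0.
have g_der (s : R) : is_derive s 1 g (dg s).
  have dL : is_derive s 1 (fun t => F (y + t *: h)) ('D_h F (y + s *: h)).
    by apply: is_derive_line; exact: diff_derivable.
  have dLj j : is_derive s 1 (fun t => F (y + t *: h) 0 j)
      ('D_h F (y + s *: h) 0 j).
    split; first exact: (derivable_mxP _ _ _).1.
    by rewrite -(derive_val (is_derive := dL)) derive_mx // mxE.
  have -> : g = \sum_j (w 0 j \*: (fun t => F (y + t *: h) 0 j)).
    apply/funext => t; rewrite fct_sumE /g mxE; apply: eq_bigr => j _.
    by rewrite mxE mulrC.
  apply: is_derive_eq; rewrite /dg mxE; apply: eq_bigr => j _.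
  by rewrite [X in _ = _ * X]mxE mulrC.
have g_cont : {within `[0, 1], continuous g}.
  apply: continuous_subspaceT => s.
  apply: differentiable_continuous; apply/derivable1_diffP.
  exact: (ex_derive (is_derive := g_der s)).
have [s s01] := MVT ltr01 (fun s _ => g_der s) g_cont.
rewrite subr0 mulr1 /g scale1r scale0r addr0.
have -> : (F (y + h) *m w^T) 0 0 - (F y *m w^T) 0 0 = sqnorm w.
  by rewrite sqnormE {3}/w mulmxBl !mxE.
move=> w_eq; apply: le_trans (DF_le s s01).
have := sqnorm_ge0 ('D_h F (y + s *: h) - w).
rewrite sqnormB -/(dg s) -w_eq.
by lra.
Qed.

Lemma sqnorm_derive_scale_le (R : realType) m p
    (W V : 'rV[R]_m -> 'rV[R]_p) (c : 'I_p -> R) (C : R) (x h : 'rV[R]_m) :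
  differentiable W x -> differentiable V x ->
  (forall y j, V y 0 j = c j * W y 0 j) -> (forall j, c j ^+ 2 <= C) ->
  sqnorm ('D_h V x) <= C * sqnorm ('D_h W x).
Proof.
move=> dW dV VE c_le.
have DW := diff_derivable (v := h) dW; have DV := diff_derivable (v := h) dV.
rewrite /sqnorm mulr_sumr; apply: ler_sum => j _.
have -> : 'D_h V x 0 j = c j * 'D_h W x 0 j.
  rewrite (derive_mx DV) (derive_mx DW) !mxE.
  have -> : (fun y => V y 0 j) = c j \*o (fun y => W y 0 j).
    by apply/funext => y; rewrite VE.
  exact: (deriveMl (c j) ((derivable_mxP _ _ _).1 DW 0 j)).
by rewrite exprMn; apply: ler_wpM2r => //; exact: sqr_ge0.
Qed.

(** * One step of the dynamics in a ball *)

(** The derivative in the direction h of the step y |-> y - g W y is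
    h - g D_h W, whose squared norm is
    |h|^2 - 2 g (D_h W . h) + g^2 |D_h W|^2. The bounds apply along the
    segment from c to x because the ball is convex. *)
Lemma sqnorm_step_le (R : realType) m (W : 'rV[R]_m -> 'rV[R]_m)
    (c x : 'rV[R]_m) (r g a b : R) :
  (forall y, differentiable W y) -> W c = 0 -> 0 <= g -> 0 < r ->
  (forall y h, eball c r y -> a * sqnorm h <= ('D_h W y *m h^T) 0 0) ->
  (forall y h, eball c r y -> sqnorm ('D_h W y) <= b * sqnorm h) ->
  eball c r x ->
  sqnorm (x - g *: W x - c) <= (1 - 2 * g * a + g ^+ 2 * b) * sqnorm (x - c).
Proof.
move=> dW Wc0 g_ge0 r_gt0 a_le b_ge xB; set h := x - c.
pose F y := y - g *: W y.
have dF y : differentiable F y.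
  apply: (differentiableB (f := id)); first by [].
  exact: differentiableZ.
have DF y : 'D_h F y = h - g *: 'D_h W y.
  have DW := derivableP (diff_derivable (v := h) (dW y)).
  have DidW := is_deriveB (is_derive_id y h) (is_deriveZ g DW).
  exact: (derive_val (is_derive := DidW)).
have -> : x - g *: W x - c = F (c + h) - F c.
  by rewrite /F Wc0 scaler0 subr0 (addrC c) subrK.
apply: sqnorm_increment_le => // s /andP[s_gt0 s_lt1].
have yB : eball c r (c + s *: h).
  apply/eball_sqnorm => //; rewrite addrAC subrr add0r sqnormZ.
  move/(eball_sqnorm _ _ r_gt0) : xB; apply: le_lt_trans.
  by rewrite ler_piMl ?sqnorm_ge0 // expr_le1 // ltW.
rewrite DF sqnormB sqnormZ.
set u := 'D_h W (c + s *: h).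
have -> : (h *m (g *: u)^T) 0 0 = g * (u *m h^T) 0 0.
  by rewrite -[h *m _]trmxK trmx_mul trmxK mxE -scalemxAl mxE.
have := ler_wpM2l g_ge0 (a_le _ h yB); rewrite -/u.
have := ler_wpM2l (sqr_ge0 g) (b_ge _ h yB); rewrite -/u.
by lra.
Qed.

(** * Positive infima and suprema *)

(** A positive infimum is a genuine one: sets that are empty or unbounded below
    have infimum 0 by convention. *)
Lemma inf_le_of_gt0 (R : realType) (E : set R) (x : R) :
  0 < inf E -> E x -> inf E <= x.
Proof.
move=> E_gt0 Ex.
have [[_ Elb]|noE] := pselect (has_inf E); first exact: ge_inf.
by move: E_gt0; rewrite inf_out // ltxx.
Qed.

Lemma le_sup_of_gt0 (R : realType) (E : set R) (x : R) :
  0 < sup E -> E x -> x <= sup E.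
Proof.
move=> E_gt0 Ex.
have [[_ Eub]|noE] := pselect (has_sup E); first exact: ub_le_sup.
by move: E_gt0; rewrite sup_out // ltxx.
Qed.

(** * The vector field of the game and its reweighting *)

(** The coordinates of [omega f] are partial derivatives of the f i, hence one
    order of smoothness is lost. *)
Lemma differentiable_omega (R : realType) (n : nat) (d : 'I_n.+1 -> nat)
    (f : 'I_n.+1 -> 'rV[R]_(\sum_i d i) -> R) (q : nat) :
  (2 <= q)%N -> (forall i, Cn q (f i)) ->
  forall x, differentiable (omega f) x.
Proof.
case: q => [|[|q]] // _ Cf x; apply: differentiable_rV => j.
have -> : (fun y => omega f y 0 j) =
    (fun y => 'D_(delta_mx 0 (tagnat.Rank (tagnat.sig1 j) (tagnat.sig2 j)))
       (f (tagnat.sig1 j)) y).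
  by apply/funext => y; rewrite !mxE.
have [_ dDf] := Cf (tagnat.sig1 j).
exact: (dDf _).1.
Qed.

Lemma omegatE (R : realType) (n : nat) (d : 'I_n.+1 -> nat)
    (f : 'I_n.+1 -> 'rV[R]_(\sum_i d i) -> R)
    (k : 'I_n.+1 -> R) x j :
  omegat f k x 0 j = (k (tagnat.sig1 j))^-1 * omega f x 0 j.
Proof. by rewrite !mxE. Qed.

Lemma differentiable_omegat (R : realType) (n : nat) (d : 'I_n.+1 -> nat)
    (f : 'I_n.+1 -> 'rV[R]_(\sum_i d i) -> R)
    (k : 'I_n.+1 -> R) :
  (forall x, differentiable (omega f) x) ->
  forall x, differentiable (omegat f k) x.
Proof.
move=> dw x; apply: differentiable_rV => j.
have -> : (fun y => omegat f k y 0 j) =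
    (k (tagnat.sig1 j))^-1 \*: (fun y => omega f y 0 j).
  by apply/funext => y; rewrite omegatE.
apply: differentiableZ.
apply: (differentiable_comp (f := omega f) (g := fun M => M 0 j)).
  exact: dw.
exact: differentiable_coord.
Qed.

Lemma omega_Gamma (R : realType) (n : nat) (d : 'I_n.+1 -> nat)
    (f : 'I_n.+1 -> 'rV[R]_(\sum_i d i) -> R)
    (k gam : 'I_n.+1 -> R) (g : R) x :
  (forall i, gam i = g / k i) -> omega f x *m Gamma d gam = g *: omegat f k x.
Proof.
move=> gamE; rewrite /omega /Gamma mul_mxrow_mxdiag; apply/rowP => j.
rewrite [LHS]mxE mul_mx_scalar [LHS]mxE gamE [RHS]mxE omegatE mulrA.
by congr (_ * _); rewrite [RHS]mxE.
Qed.

(** * Convergence *)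

(** From 1 - c <= exp (- c), the left-hand side is at most exp (- c t) N, and
    the lower bound on t says that exp (c t) >= (r / eps)^2. *)
Lemma geometric_lt_sqr (R : realType) (c N r eps : R) (t : nat) :
  0 < c <= 1 -> 0 < r -> 0 < eps -> 0 <= N < r ^+ 2 ->
  Num.ceil (2 / c * ln (r / eps)) <= t%:Z ->
  (1 - c) ^+ t * N < eps ^+ 2.
Proof.
move=> /andP[c_gt0 c_le1] r_gt0 eps_gt0 /andP[N_ge0 N_lt].
rewrite ceil_le_int => t_ge.
have e_gt0 : 0 < expR (c * t%:R) by exact: expR_gt0.
have pow_le : (1 - c) ^+ t <= (expR (c * t%:R))^-1.
  rewrite -expRN -mulNr expRM_natr.
  apply: lerXn2r; rewrite ?nnegrE ?subr_ge0 ?expR_ge0 //.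
  exact: expR_ge1Dx.
have ratio_le : (r / eps) ^+ 2 <= expR (c * t%:R).
  have q_gt0 : 0 < r / eps by exact: divr_gt0.
  rewrite -[r / eps]lnK ?posrE // -expRM_natr ler_expR.
  by rewrite mulrC -(ler_pdivrMl _ _ c_gt0) mulrA (mulrC c^-1).
apply: (le_lt_trans (ler_wpM2r N_ge0 pow_le)).
rewrite ltr_pdivrMl //; apply: (lt_le_trans N_lt).
by rewrite -ler_pdivrMr ?exprn_gt0 // -expr_div_n.
Qed.

Theorem theorem2 (R : realType) (n : nat) (d : 'I_n.+1 -> nat)
  (f : 'I_n.+1 -> 'rV[R]_(\sum_i d i) -> R)
  (q : nat) (hq : (2 <= q)%N) (hf : forall i, Cn q (f i))
  (L : R) (hL : elipschitz L (omega f))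
  (xs : 'rV[R]_(\sum_i d i))
  (hNash : differential_Nash f xs) (hstable : stable f xs)
  (k : 'I_n.+1 -> R) (hk : forall i, 1 <= k i)
  (kmin : R) (hkmin : kmin = \big[Num.min/k ord0]_i k i)
  (r : R) (hr : largest_radius f k xs r)
  (alpha : R) (halpha : alpha = alpha_of f xs r) (alpha_gt0 : 0 < alpha)
  (beta : R) (hbeta : beta = beta_of f xs r)
  (alphat : R) (halphat : alphat = alphat_of f k xs r)
  (x0 : 'rV[R]_(\sum_i d i)) (hx0 : eball xs r x0)
  (hab : alpha < kmin * beta)
  (haat : Num.sqrt alpha / kmin <= Num.sqrt alphat)
  (gam : 'I_n.+1 -> R) (hgam : forall i, gam i = Num.sqrt alpha / (beta * k i))
  (eps : R) (heps : 0 < eps)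
  (x : nat -> 'rV[R]_(\sum_i d i)) (hx_init : x 0%N = x0)
  (hx_step : forall t, x t.+1 = x t - omega f (x t) *m Gamma d gam) :
  forall t : nat,
    Num.ceil (2 * (beta * kmin / alpha) * ln (r / eps)) <= t%:Z ->
    eball xs eps (x t).
Proof.
have [r_gt0 [_ posB] _] := hr.
have kmin_ge1 : 1 <= kmin.
  by rewrite hkmin; apply: le_bigmin => // i _; exact: hk.
have kmin_gt0 : 0 < kmin := lt_le_trans ltr01 kmin_ge1.
have kmin_le i : kmin <= k i by rewrite hkmin; exact: bigmin_le.
have beta_gt0 : 0 < beta.
  by rewrite -(pmulr_rgt0 _ kmin_gt0) (lt_trans alpha_gt0).
have alphat_gt0 : 0 < alphat.
  by rewrite -sqrtr_gt0 (lt_le_trans _ haat) // divr_gt0 // sqrtr_gt0.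
have dw := differentiable_omega hq hf.
have dwt := differentiable_omegat k dw.
pose W := omegat f k.
have Wxs0 : W xs = 0.
  by apply/rowP => j; rewrite omegatE hNash.1 !mxE mulr0.
have W_mono y h : eball xs r y ->
    Num.sqrt alpha / kmin * sqnorm h <= ('D_h W y *m h^T) 0 0.
  move=> yB; apply: (le_trans (ler_wpM2r (sqnorm_ge0 h) haat)).
  have Ssym : (gameSt f k y)^T = gameSt f k y.
    by rewrite /gameSt /sympart linearZ /= linearD /= trmxK addrC.
  have a_le : alphat <=
      lambda (\sum_i d i)%N ((gameSt f k y)^T *m gameSt f k y).
    rewrite halphat; apply: inf_le_of_gt0; last by exists y.
    by rewrite halphat in alphat_gt0.
  apply: le_trans (posdef_lambda_sqrt h Ssym (posB y yB).1 a_le) _.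
  by rewrite sympart_quad /gameJt /Jac trmxK -(deriveEjacobian h (dwt y)).
have W_bound y h : eball xs r y ->
    sqnorm ('D_h W y) <= kmin ^- 2 * beta * sqnorm h.
  move=> yB; rewrite -mulrA.
  have k_le (j : 'I_(\sum_i d i)) : (k (tagnat.sig1 j))^-1 ^+ 2 <= kmin ^- 2.
    rewrite exprVn lef_pV2 ?posrE ?exprn_gt0 ?(lt_le_trans kmin_gt0) //.
    by rewrite ler_pXn2r ?nnegrE // ltW // (lt_le_trans kmin_gt0).
  have := sqnorm_derive_scale_le h (dw y) (dwt y) (omegatE f k) k_le.
  move=> /le_trans; apply.
  rewrite ler_pM2l ?invr_gt0 ?exprn_gt0 // (deriveEjacobian h (dw y)).
  have b_ge : lambda 1 ((gameJ f y)^T *m gameJ f y) <= beta.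
    rewrite hbeta; apply: le_sup_of_gt0; last by exists y.
    by rewrite hbeta in beta_gt0.
  apply: le_trans (ler_wpM2r (sqnorm_ge0 h) b_ge).
  have -> : sqnorm (h *m jacobian (omega f) y) =
      (h *m ((gameJ f y)^T *m gameJ f y) *m h^T) 0 0.
    by rewrite sqnorm_mul /gameJ /Jac trmxK.
  have JJsym : ((gameJ f y)^T *m gameJ f y)^T = (gameJ f y)^T *m gameJ f y.
    by rewrite trmx_mul trmxK.
  by case/andP: (rayleigh_lambda h JJsym).
pose c := alpha / (beta * kmin).
have c_gt0 : 0 < c by rewrite divr_gt0 // mulr_gt0.
have c_le1 : c <= 1 by rewrite ler_pdivrMr ?mulr_gt0 // mul1r ltW // mulrC.
have step t : eball xs r (x t) ->
    sqnorm (x t.+1 - xs) <= (1 - c) * sqnorm (x t - xs).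
  have gamE i : gam i = Num.sqrt alpha / beta / k i by rewrite hgam invfM mulrA.
  move=> xB; rewrite hx_step (omega_Gamma f (x t) gamE).
  have g_ge0 : 0 <= Num.sqrt alpha / beta by rewrite divr_ge0 ?sqrtr_ge0 // ltW.
  apply: le_trans (sqnorm_step_le dwt Wxs0 g_ge0 r_gt0 W_mono W_bound xB) _.
  apply: ler_wpM2r; first exact: sqnorm_ge0.
  have -> : 2 * (Num.sqrt alpha / beta) * (Num.sqrt alpha / kmin) = 2 * c.
    rewrite /c -[in RHS](sqr_sqrtr (ltW alpha_gt0)); field.
    by rewrite !gt_eqF.
  have -> : (Num.sqrt alpha / beta) ^+ 2 * (kmin ^- 2 * beta) = c / kmin.
    rewrite /c -[in RHS](sqr_sqrtr (ltW alpha_gt0)); field.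
    by rewrite !gt_eqF.
  have : c / kmin <= c by rewrite ler_piMr ?(ltW c_gt0) // invf_le1.
  rewrite -addrA lerD2l mulr_natl mulr2n opprD -addrA gerDl addrC.
  by rewrite subr_le0.
have decay t : sqnorm (x t - xs) <= (1 - c) ^+ t * sqnorm (x0 - xs) /\
    eball xs r (x t).
  elim: t => [|t [IH xB]]; first by rewrite hx_init expr0 mul1r.
  have xS := step t xB; split.
    by rewrite exprS -mulrA (le_trans xS) // ler_wpM2l // subr_ge0.
  apply/eball_sqnorm => //; move/(eball_sqnorm _ _ r_gt0) : xB.
  apply: le_lt_trans.
  by apply: le_trans xS _; rewrite ler_piMl ?sqnorm_ge0 // gerBl ltW.
move=> t; have -> : 2 * (beta * kmin / alpha) = 2 / c.
  by rewrite /c; field; rewrite !gt_eqF.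
move=> t_ge; apply/eball_sqnorm => //; apply: (le_lt_trans (decay t).1).
apply: (geometric_lt_sqr _ r_gt0) => //; first by rewrite c_gt0 c_le1.
by rewrite sqnorm_ge0; exact/eball_sqnorm.
Qed.
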